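(* Let $f:\mathcal{C}_\tau\times\mathbb{R}^m\to\mathbb{R}^n$ with $f(0,0)=0$ and $p:\mathbb{R}^n\to\mathbb{R}^m$ with $p(0)=0$, and suppose that Assumption A and Assumption B (both stated in the context) hold, with the corresponding functions $\alpha_1,\alpha_2,\alpha_3,\chi$ and constant $\mu\in[0,1)$. Consider the closed-loop event-triggered system $$x(k+1)=g(x_k,e(k))=f\big(x_k,p(x(k_i))\big),\quad k\in[k_i,k_{i+1}),\qquad x_0=\varphi\in\mathcal{C}_\tau,$$ where $e(k)=x(k_i)-x(k)$ for $k\in[k_i,k_{i+1})$ and the event times $\{k_i\}$ are determined by $$k_{i+1}=\min\left\{k>k_i \;\middle|\; \chi(\|e(k)\|)>\sigma\,\alpha_1(\|x(k)\|)+\chi\big(a(1-b)^k\big)\right\}$$ (where, on the right-hand side, $e(k)=x(k_i)-x(k)$), with constants $\mu>\sigma\ge 0$, $a\ge 0$ and $1>b>0$. Let $c:=\mu-\sigma$. Then: 1) If $a=0$ and $\sigma>0$, the closed-loop system is globally asymptotically stable (GAS). 2) If $a>0$, the closed-loop system is also GAS. If, further, $b<c$ and the parameters $a,b,\sigma$ satisfy $$a\ \ge\ \frac{M L_1}{1-b}\left(\bar L_{1,1}+\frac{\bar L_{1,2}}{(1-b)^{\tau}}+\bar L_2\right),$$ where the constants $M,L_1,\bar L_{1,1},\bar L_{1,2},\bar L_2$ (depending on the initial function $\varphi$) are those defined in the context, then the sequence of event times $\{k_i\}$ is strongly nontrivial, that is, $k_{i+1}-k_i\ge 2$ for all $i$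.
   Context: Notation. $\mathbb{Z}^+$ is the set of nonnegative integers, $\mathbb{R}^+$ the set of nonnegative reals, $\|\cdot\|$ the Euclidean norm; intervals $[k_i,k_{i+1})$ are intervals of integers. For a fixed $\tau\in\mathbb{Z}^+$ (the maximum delay), $\mathbb{N}_{-\tau}=\{-\tau,\dots,-1,0\}$, $\mathbb{N}_{-\tau\setminus 0}=\mathbb{N}_{-\tau}\setminus\{0\}$, $\mathcal{C}_\tau=\{\phi:\mathbb{N}_{-\tau}\to\mathbb{R}^n\}$, $\mathcal{C}_{\tau\setminus 0}=\{\phi:\mathbb{N}_{-\tau\setminus 0}\to\mathbb{R}^n\}$. For $\phi\in\mathcal{C}_\tau$, $\phi_{\tau\setminus 0}\in\mathcal{C}_{\tau\setminus 0}$ is its restriction to $\mathbb{N}_{-\tau\setminus 0}$, $\|\phi\|_\tau=\max_{s\in\mathbb{N}_{-\tau}}\|\phi(s)\|$ and $\|\phi\|_{\tau\setminus 0}=\max_{s\in\mathbb{N}_{-\tau\setminus 0}}\|\phi(s)\|$. For a sequence $x$, $x_k\in\mathcal{C}_\tau$ is defined by $x_k(s)=x(k+s)$, $s\in\mathbb{N}_{-\tau}$. A continuous $\alpha:\mathbb{R}^+\to\mathbb{R}$ is of class $\mathcal{K}$ if it is strictly increasing with $\alpha(0)=0$; it is of class $\mathcal{K}_\infty$ if moreover $\alpha(s)\to\infty$ as $s\to\infty$. System. $g(\phi,e):=f(\phi,p(e+\phi(0)))$ for $\phi\in\mathcal{C}_\tau$, $e\in\mathbb{R}^n$. The control input $u(k)=p(x(k_i))$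 is held constant for $k\in[k_i,k_{i+1})$. The first event time is the initial time $k=0$; if the set defining $k_{i+1}$ is empty, no further event occurs and $k_{i+1}=\infty$. Assumption A. There exist $V_1:\mathbb{R}^n\to\mathbb{R}^+$, $V_2:\mathcal{C}_{\tau\setminus 0}\to\mathbb{R}^+$, $\alpha_1,\alpha_2,\alpha_3\in\mathcal{K}_\infty$, $\chi\in\mathcal{K}$ and a constant $\mu\in[0,1)$ such that for all $\phi\in\mathcal{C}_\tau$ (and all $e\in\mathbb{R}^n$): (i) $\alpha_1(\|\phi(0)\|)\le V_1(\phi(0))\le\alpha_2(\|\phi(0)\|)$; (ii) $0\le V_2(\phi_{\tau\setminus 0})\le\alpha_3(\|\phi\|_{\tau\setminus 0})$; (iii) $V(\phi):=V_1(\phi(0))+V_2(\phi_{\tau\setminus 0})$ satisfies $V(\phi^* )-V(\phi)\le-\mu V(\phi)+\chi(\|e\|)$, where $\phi^*(0)=g(\phi,e)$ and $\phi^*(s)=\phi(s+1)$ for $s\in\mathbb{N}_{-\tau\setminus 0}$. Locally Lipschitz. A function $f:\mathcal{C}_\tau\times\mathbb{R}^m\to\mathbb{R}^n$ is locally Lipschitz if for each $\psi\in\mathcal{C}_\tau$, $u\in\mathbb{R}^m$ there are positive constants $l_{1,1},l_{1,2},l_2,R$ such that $\|f(\phi,v)-f(\psi,u)\|\le l_{1,1}\|\phi(0)-\psi(0)\|+l_{1,2}\|\phi-\psi\|_{\tau\setminus 0}+l_2\|v-u\|$ for all $\phi\in\mathcal{B}^\tau_R(\psi)=\{\phi\in\mathcal{C}_\tau:\|\phi-\psi\|_\tau<R\}$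 and $v\in\mathcal{B}_R(u)=\{v:\|v-u\|<R\}$. For single-variable functions the condition is obtained by fixing the first argument. Assumption B. $\alpha_1^{-1}$, $\chi$ and $p$ are locally Lipschitz, and $(\phi,u)\mapsto f(\phi,u)$ is locally Lipschitz. Constants. $c=\mu-\sigma$; $\tilde M:=\alpha_2(\|\varphi(0)\|)+\alpha_3(\|\varphi\|_{\tau\setminus 0})$; $L$ is the Lipschitz constant of $\chi$ on $[0,a]$; for any given constant $\xi$ with $0<\xi<b$, $$\bar M=\begin{cases}\dfrac{aL}{|c-b|}, & b\ne c,\\[2mm] \dfrac{aL}{(1-c)\left(\ln(1-\xi)-\ln(1-c)\right)}, & b=c<1;\end{cases}$$ $M:=\bar M+\tilde M$; $L_1$ is the Lipschitz constant of $\alpha_1^{-1}$ on $[0,M]$. With $\bar f(\phi,u):=\phi(0)-f(\phi,u)$, the constants $\bar L_{1,1},\bar L_{1,2},\bar L_2$ are Lipschitz constants (of $(\phi,x)\mapsto\bar f(\phi,p(x))$) such that $$\|\bar f(\phi,p(x))\|\le\bar L_{1,1}\|\phi(0)\|+\bar L_{1,2}\|\phi\|_{\tau\setminus 0}+\bar L_2\|x\|$$ for all $\phi\in\mathcal{B}^\tau_R(0)$ and $x\in\mathcal{B}_R(0)$ with $R=\alpha_1^{-1}(M)$. GAS. The (trivial solution of the) closed-loop system is globally attractive if $\lim_{k\to\infty}\|x(k)\|=0$ for every $\varphi\in\mathcal{C}_\tau$. It is stable if for every $\varepsilon>0$ there is $\delta>0$ such that $\|\varphi\|_\tau<\delta$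 implies $\|x(k)\|\le\varepsilon$ for all $k\ge 0$. It is GAS if it is stable and globally attractive.
   Formalization: The final claim fails for some large past initial data; what is proved is k_{i+1}-k_i ≥ 2 for every i with k_i ≥ τ, and for all i under the added hypothesis ‖φ‖_τ < α_1^{-1}(M). *)

(* Defs.v *)
From HB Require Import structures.
From mathcomp Require Import all_boot all_order all_algebra.
From mathcomp Require Import all_classical all_reals all_analysis.
Set Implicit Arguments.
Unset Strict Implicit.
Unset Printing Implicit Defensive.
Import Order.TTheory GRing.Theory Num.Theory.
Import numFieldNormedType.Exports.
Local Open Scope classical_set_scope.
Local Open Scope ring_scope.

(* The norm [`|v|] that the library puts on matrices is the sup norm. *)
Definition enorm (R : realType) (n : nat) (v : 'cV[R]_n) : R :=
  Num.sqrt (\sum_(i < n) v i 0 ^+ 2).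

(* [seg R n tau.+1] is C_tau, with [phi i] standing for phi(-i);
   [seg R n tau] is C_{tau\0}, with [psi j] standing for psi(-(j+1)). *)
Notation seg R n k := {ffun 'I_k -> 'cV[R]_n}.

Definition past (R : realType) (n tau : nat) (phi : seg R n tau.+1) :
    seg R n tau :=
  [ffun j => phi (lift ord0 j)].

(* Used for both ||.||_tau and ||.||_{tau\0}; it is 0 on the empty range
   (||.||_{tau\0} with tau = 0). *)
Definition segnorm (R : realType) (n k : nat) (phi : seg R n k) : R :=
  \big[Num.max/0]_(i < k) enorm (phi i).

(* x_k; only the values of x at times >= -tau matter. *)
Definition window (R : realType) (n tau : nat) (x : int -> 'cV[R]_n)
    (k : nat) : seg R n tau.+1 :=
  [ffun i : 'I_tau.+1 => x (k%:Z - (i : nat)%:Z)].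

(* phi^*(0) = z and phi^*(s) = phi(s+1) for -tau <= s < 0. *)
Definition push (R : realType) (n tau : nat) (phi : seg R n tau.+1)
    (z : 'cV[R]_n) : seg R n tau.+1 :=
  [ffun i => if unlift ord0 i is Some j then phi (widen_ord (leqnSn tau) j)
             else z].

(* Functions R^+ -> R are represented by functions R -> R whose values at
   negative arguments are never constrained. *)
Definition class_K (R : realType) (alpha : R -> R) : Prop :=
  [/\ {within `[0, +oo[, continuous alpha},
      forall s t, 0 <= s -> s < t -> alpha s < alpha t
    & alpha 0 = 0].

Definition class_Koo (R : realType) (alpha : R -> R) : Prop :=
  class_K alpha /\ alpha s @[s --> +oo] --> +oo.

Definition Kinv (R : realType) (alpha : R -> R) : R -> R :=
  'pinv_(fun=> 0) [set s : R | 0 <= s] alpha.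

Definition locally_lipschitz_fun (R : realType) (n m tau : nat)
    (f : seg R n tau.+1 -> 'cV[R]_m -> 'cV[R]_n) : Prop :=
  forall psi u, exists l11 l12 l2 r,
    [/\ 0 < l11, 0 < l12, 0 < l2, 0 < r &
      forall phi v, segnorm (phi - psi) < r -> enorm (v - u) < r ->
        enorm (f phi v - f psi u) <=
          l11 * enorm (phi ord0 - psi ord0)
          + l12 * segnorm (past (phi - psi)) + l2 * enorm (v - u)].

Definition locally_lipschitz_vec (R : realType) (n m : nat)
    (p : 'cV[R]_n -> 'cV[R]_m) : Prop :=
  forall u, exists l r, [/\ 0 < l, 0 < r &
    forall v, enorm (v - u) < r -> enorm (p v - p u) <= l * enorm (v - u)].

Definition locally_lipschitz_nneg (R : realType) (h : R -> R) : Prop :=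
  forall u, 0 <= u -> exists l r, [/\ 0 < l, 0 < r &
    forall v, 0 <= v -> `|v - u| < r -> `|h v - h u| <= l * `|v - u|].

Section System.
Context {R : realType} {n m tau : nat}.
Variables (f : seg R n tau.+1 -> 'cV[R]_m -> 'cV[R]_n)
          (p : 'cV[R]_n -> 'cV[R]_m).

Definition feedback (phi : seg R n tau.+1) (e : 'cV[R]_n) : 'cV[R]_n :=
  f phi (p (e + phi ord0)).

Definition lyapunov (V1 : 'cV[R]_n -> R) (V2 : seg R n tau -> R)
    (phi : seg R n tau.+1) : R :=
  V1 (phi ord0) + V2 (past phi).

Record assumptionA (V1 : 'cV[R]_n -> R) (V2 : seg R n tau -> R)
    (alpha1 alpha2 alpha3 chi : R -> R) (mu : R) : Prop := AssumptionA {
  A_alpha1 : class_Koo alpha1;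
  A_alpha2 : class_Koo alpha2;
  A_alpha3 : class_Koo alpha3;
  A_chi : class_K chi;
  A_mu : 0 <= mu < 1;
  A_V1_ge0 : forall z, 0 <= V1 z;
  A_V1 : forall phi : seg R n tau.+1,
    alpha1 (enorm (phi ord0)) <= V1 (phi ord0) <= alpha2 (enorm (phi ord0));
  A_V2 : forall phi : seg R n tau.+1,
    0 <= V2 (past phi) <= alpha3 (segnorm (past phi));
  A_decay : forall (phi : seg R n tau.+1) (e : 'cV[R]_n),
    lyapunov V1 V2 (push phi (feedback phi e)) - lyapunov V1 V2 phi
      <= - mu * lyapunov V1 V2 phi + chi (enorm e)
}.

Definition assumptionB (alpha1 chi : R -> R) : Prop :=
  [/\ locally_lipschitz_nneg (Kinv alpha1), locally_lipschitz_nneg chi,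
      locally_lipschitz_vec p & locally_lipschitz_fun f].

Variables (alpha1 chi : R -> R) (sigma a b : R).

Definition triggers (x : int -> 'cV[R]_n) (ki k : nat) : Prop :=
  (ki < k)%N /\
  chi (enorm (x ki%:Z - x k%:Z)) >
    sigma * alpha1 (enorm (x k%:Z)) + chi (a * (1 - b) ^+ k).

(* [t i = Some k] means k_i = k, [t i = None] means k_i = oo. *)
Definition event_times (x : int -> 'cV[R]_n) (t : nat -> option nat) : Prop :=
  t 0%N = Some 0%N /\
  forall i, match t i, t i.+1 with
  | Some ki, Some kj =>
      triggers x ki kj /\ forall k, triggers x ki k -> (kj <= k)%N
  | Some ki, None => forall k, ~ triggers x ki k
  | None, ti1 => ti1 = None
  end.

Definition before (k : nat) (o : option nat) : bool :=
  if o is Some k' then (k < k')%N else true.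

Definition closed_loop (phi : seg R n tau.+1) (x : int -> 'cV[R]_n)
    (t : nat -> option nat) : Prop :=
  [/\ window tau x 0 = phi,
      event_times x t &
      forall i ki k, t i = Some ki -> (ki <= k)%N -> before k (t i.+1) ->
        x k.+1%:Z = feedback (window tau x k) (x ki%:Z - x k%:Z)].

Definition globally_attractive : Prop :=
  forall phi x t, closed_loop phi x t ->
    (fun k : nat => enorm (x k%:Z)) @ \oo --> (0 : R).

Definition stable : Prop :=
  forall eps : R, 0 < eps -> exists2 delta : R, 0 < delta &
    forall phi x t, segnorm phi < delta -> closed_loop phi x t ->
      forall k : nat, enorm (x k%:Z) <= eps.

Definition GAS : Prop := stable /\ globally_attractive.

End System.

(* Strong nontriviality is the case k0 = 0. The case k0 = tau does not involve
   the initial function: every segment x_{k_i} with k_i >= tau consists of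
   states x(k), k >= 0, on which the Lyapunov estimate gives a bound, whereas
   nothing in the assumptions bounds phi(s), s < 0, in terms of V(phi). *)
Definition strongly_nontrivial_from (k0 : nat) (t : nat -> option nat) : Prop :=
  forall i ki kj, t i = Some ki -> t i.+1 = Some kj -> (k0 <= ki)%N ->
    (ki + 2 <= kj)%N.

Definition strongly_nontrivial (t : nat -> option nat) : Prop :=
  strongly_nontrivial_from 0 t.

Definition Mbar (R : realType) (a b c L xi : R) : R :=
  if b == c then a * L / ((1 - c) * (ln (1 - xi) - ln (1 - c)))
  else a * L / `|c - b|.

Definition Mtilde (R : realType) (n tau : nat) (alpha2 alpha3 : R -> R)
    (phi : seg R n tau.+1) : R :=
  alpha2 (enorm (phi ord0)) + alpha3 (segnorm (past phi)).

(* The three constants bound fbar(phi, p(x)) = phi(0) - f(phi, p(x)), which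
   vanishes at the origin, on the balls of radius r centred there. *)
Definition fbar_lipschitz (R : realType) (n m tau : nat)
    (f : seg R n tau.+1 -> 'cV[R]_m -> 'cV[R]_n) (p : 'cV[R]_n -> 'cV[R]_m)
    (r L11 L12 L2 : R) : Prop :=
  [/\ 0 <= L11, 0 <= L12, 0 <= L2 &
    forall (phi : seg R n tau.+1) (x : 'cV[R]_n),
      segnorm phi < r -> enorm x < r ->
      enorm (phi ord0 - f phi (p x)) <=
        L11 * enorm (phi ord0) + L12 * segnorm (past phi) + L2 * enorm x].

(* Main.v *)
Require Import Defs.
From mathcomp Require Import all_boot all_order all_algebra.
From mathcomp Require Import all_classical all_reals all_analysis.
From mathcomp Require Import zify ring lra.
Import Order.TTheory GRing.Theory Num.Theory.
Import numFieldNormedType.Exports.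
Local Open Scope classical_set_scope.
Local Open Scope ring_scope.

(** Between two events the error e(k) has not triggered, and at an event it is
    zero, so chi(|e(k)|) <= sigma alpha1(|x(k)|) + chi(a(1-b)^k) at every time
    k ([no_trigger_bound]). Since alpha1(|x(k)|) <= V(x_k), the dissipation
    inequality becomes the scalar recursion, with c = mu - sigma in (0,1),

      V(x_{k+1}) <= (1-c) V(x_k) + chi(a(1-b)^k)          ([V_decay]),

    whose forcing term tends to 0. Everything is read off this recursion, and
    the lower bound alpha1(|x(k)|) <= V(x_k) turns estimates on V into
    estimates on the state.

    Attractivity: once the forcing is below c B, the recursion contracts
    towards [0, B], for every B > 0 ([V_ultimate]).

    Stability is less direct when a > 0, because the forcing does not shrink
    with the initial function: for small k it may be large compared with V(x_0).
    One chooses a time K after which the forcing is below c alpha1(eps). Up to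
    time K no Lyapunov function is needed: f(phi, p(z)) is continuous at the
    equilibrium, and x(k+1) depends only on x_k and on one x(j), 0 <= j <= k, so
    finitely many steps keep a small initial function small whatever the event
    times are ([finite_horizon]). After K the set V <= alpha1(eps) is invariant.

    Strong nontriviality: for b < c the forcing decays more slowly than
    (1-c)^k, so solving the recursion gives V(x_k) < M (1-b)^k
    ([V_exponential]), and hence |x(k)| <= M L1 (1-b)^k ([state_decay]). At an
    event time k the first error is e(k+1) = x(k) - f(x_k, p(x(k))), which the
    constants L11, L12, L2 bound in terms of these states; the condition on a
    says exactly that this bound does not exceed a(1-b)^{k+1}, so that k+1 is
    not an event ([inter_event_gap]).
    The delayed states cost the factor (1-b)^{-tau}; those at negative times,
    which V does not control, are present only when k < tau and are then
    bounded by the hypothesis on the initial function ([window_decay]). *)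

(** * Comparison functions *)

Lemma class_K_le (R : realType) (al : R -> R) (s t : R) :
  class_K al -> 0 <= s -> s <= t -> al s <= al t.
Proof.
case=> _ incr _ s0; rewrite le_eqVlt => /orP[/eqP -> //|st].
exact/ltW/incr.
Qed.

Lemma class_K_ge0 (R : realType) (al : R -> R) (s : R) :
  class_K al -> 0 <= s -> 0 <= al s.
Proof. by move=> K s0; case: (K) => _ _ <-; exact: class_K_le. Qed.

Lemma class_K_gt0 (R : realType) (al : R -> R) (s : R) :
  class_K al -> 0 < s -> 0 < al s.
Proof. by case=> _ incr al0 s0; rewrite -[X in X < _]al0; exact: incr. Qed.

Lemma class_K_lt_inv (R : realType) (al : R -> R) (s t : R) :
  class_K al -> 0 <= t -> al s < al t -> s < t.
Proof.
move=> K t0; rewrite !ltNge; apply: contra => ts; exact: class_K_le.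
Qed.

Lemma class_K_le_inv (R : realType) (al : R -> R) (s t : R) :
  class_K al -> 0 <= t -> al s <= al t -> s <= t.
Proof.
move=> [_ incr _] t0; rewrite !leNgt; apply: contra => ts; exact: incr.
Qed.

(** Only right continuity at 0 is extracted from the class K hypothesis; by
    monotonicity a bound at the single point d is one on all of [0, d]. *)
Lemma class_K_small (R : realType) (al : R -> R) (e : R) :
  class_K al -> 0 < e -> exists2 d, 0 < d & al d < e.
Proof.
move=> K e0; have [+ _ al0] := K.
move=> /subspace_continuousP /(_ 0).
rewrite /= in_itv /= lexx => /(_ isT) /cvgrPdist_lt /(_ _ e0).
move=> /nbhs_ballP[r /= r0 rP].
exists (r / 2); first by rewrite divr_gt0.
have /rP : ball (0 : R) r (r / 2).
  by rewrite /ball /= sub0r normrN gtr0_norm ?divr_gt0//; lra.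
rewrite /= in_itv /= andbT => /(_ (ltW (divr_gt0 r0 (ltr0Sn _ 1)))).
by rewrite /from_subspace al0 sub0r normrN; exact/le_lt_trans/ler_norm.
Qed.

Lemma Kinv_K (R : realType) (al : R -> R) (s : R) :
  class_K al -> 0 <= s -> Kinv al (al s) = s.
Proof.
move=> K s0; rewrite /Kinv pinvKV ?inE//.
move=> u v /[!inE] u0 v0 uv.
by apply: le_anti; apply/andP; split; apply: (class_K_le_inv _ al); rewrite ?uv.
Qed.

(** Intermediate value theorem on [0, s], for s so large that al s >= y. It is
    what makes [Kinv al] an honest inverse instead of a default value. *)
Lemma class_Koo_surj (R : realType) (al : R -> R) (y : R) :
  class_Koo al -> 0 <= y -> exists2 s, 0 <= s & al s = y.
Proof.
move=> [K /cvgryPge /(_ y) [A [_ Ay]]] y0.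
have [cont _ al0] := K.
pose s := Num.max 0 A + 1.
have s0 : 0 <= s by rewrite addr_ge0// le_max lexx.
have ys : y <= al s.
  by apply: Ay; rewrite /s ltr_pwDr// le_max lexx orbT.
have [||u] := @IVT _ al 0 s y s0.
- apply: continuous_subspaceW cont => z /=.
  by rewrite !in_itv /= andbT => /andP[].
- by rewrite al0 ge_min y0 le_max ys orbT.
by rewrite in_itv /= => /andP[u0 _] uy; exists u.
Qed.

Lemma lt_Kinv (R : realType) (al : R -> R) (s y : R) :
  class_Koo al -> 0 <= s -> al s < y -> s < Kinv al y.
Proof.
move=> Koo s0 sy; have K := Koo.1.
have [u u0 uy] := class_Koo_surj _ _ _ Koo
  (le_trans (class_K_ge0 _ _ _ K s0) (ltW sy)).
by rewrite -uy Kinv_K//; apply: (class_K_lt_inv _ al); rewrite ?uy.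
Qed.

Lemma Kinv_lipschitz_bound (R : realType) (al : R -> R) (L M y : R) :
  class_Koo al -> L.-lipschitz_(`[0, M]%classic) (Kinv al) ->
  0 <= y <= M -> Kinv al y <= L * y.
Proof.
move=> Koo lip /andP[y0 yM]; have K := Koo.1.
have Kinv0 : Kinv al 0 = 0 by case: (K) => _ _ {1}<-; exact: Kinv_K.
have := lip (y, 0); rewrite /self_sub /= Kinv0 !subr0 (ger0_norm y0) !in_itv /=.
rewrite y0 yM lexx (le_trans y0 yM) => /(_ (conj isT isT)).
exact/le_trans/ler_norm.
Qed.

Lemma class_K_lipschitz_bound (R : realType) (chi : R -> R) (L a y : R) :
  class_K chi -> L.-lipschitz_(`[0, a]%classic) chi ->
  0 <= y <= a -> chi y <= L * y.
Proof.
move=> [_ _ chi0] lip /andP[y0 ya].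
have := lip (y, 0); rewrite /self_sub /= chi0 !subr0 (ger0_norm y0) !in_itv /=.
rewrite y0 ya lexx (le_trans y0 ya) => /(_ (conj isT isT)).
exact/le_trans/ler_norm.
Qed.

(** * Scalar linear recursions *)

(** B is the fixed point of v |-> q v + (1 - q) B, so the recursion
    reads v k.+1 - B <= q (v k - B). *)
Lemma recursion_const (R : realType) (v : nat -> R) (q B : R) :
  0 <= q -> (forall k, v k.+1 <= q * v k + (1 - q) * B) ->
  forall k, v k <= q ^+ k * v 0%N + (1 - q ^+ k) * B.
Proof.
move=> q0 vS; elim=> [|k IH]; first by rewrite expr0; lra.
apply: le_trans (vS k) _.
apply: (@le_trans _ _
  (q * (q ^+ k * v 0%N + (1 - q ^+ k) * B) + (1 - q) * B)).
  by rewrite lerD2r ler_wpM2l.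
by rewrite exprS le_eqVlt; apply/orP; left; apply/eqP; ring.
Qed.

(** The right-hand side solves the recursion with equality: A s^k / (s - q) is a
    particular solution and q^k the homogeneous one. *)
Lemma recursion_geometric (R : realType) (v : nat -> R) (q s A : R) :
  0 <= q -> q < s -> (forall k, v k.+1 <= q * v k + A * s ^+ k) ->
  forall k, v k <= q ^+ k * v 0%N + A / (s - q) * (s ^+ k - q ^+ k).
Proof.
move=> q0 qs vS; elim=> [|k IH]; first by rewrite !expr0; lra.
apply: le_trans (vS k) _.
apply: (@le_trans _ _ (q * (q ^+ k * v 0%N + A / (s - q) * (s ^+ k - q ^+ k))
  + A * s ^+ k)); first by rewrite lerD2r ler_wpM2l.
rewrite !exprS le_eqVlt; apply/orP; left; apply/eqP; field.
by rewrite subr_eq0 gt_eqF.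
Qed.

Lemma expr_small (R : realType) (q e : R) :
  0 <= q < 1 -> 0 < e -> exists K, forall k, (K <= k)%N -> q ^+ k < e.
Proof.
move=> /andP[q0 q1] e0.
have nq : `|q| < 1 by rewrite ger0_norm.
have /cvgr0Pnorm_lt /(_ _ e0) [K _ KP] := cvg_expr nq.
exists K => k /KP /=; rewrite ger0_norm ?exprn_ge0//.
Qed.

(** * Segments of a trajectory *)

Lemma enorm_ge0 (R : realType) (n : nat) (v : 'cV[R]_n) : 0 <= enorm v.
Proof. exact: sqrtr_ge0. Qed.

Lemma enorm0 (R : realType) (n : nat) : enorm (0 : 'cV[R]_n) = 0.
Proof.
by rewrite /enorm big1 ?sqrtr0// => i _; rewrite mxE expr0n.
Qed.

Lemma enorm_le_segnorm (R : realType) (n k : nat) (phi : seg R n k) i :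
  enorm (phi i) <= segnorm phi.
Proof. exact: (le_bigmax _ (fun i => enorm (phi i))). Qed.

Lemma segnorm_ge0 (R : realType) (n k : nat) (phi : seg R n k) :
  0 <= segnorm phi.
Proof. by apply/bigmax_geP; left. Qed.

Lemma segnorm_le (R : realType) (n k : nat) (phi : seg R n k) (e : R) :
  0 <= e -> (forall i, enorm (phi i) <= e) -> segnorm phi <= e.
Proof. by move=> e0 h; apply/bigmax_leP; split. Qed.

Lemma segnorm_lt (R : realType) (n k : nat) (phi : seg R n k) (e : R) :
  0 < e -> (forall i, enorm (phi i) < e) -> segnorm phi < e.
Proof. by move=> e0 h; apply/bigmax_ltP; split. Qed.

Lemma segnorm_past_le (R : realType) (n tau : nat) (phi : seg R n tau.+1) :
  segnorm (past phi) <= segnorm phi.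
Proof.
apply: segnorm_le => [|i]; first exact: segnorm_ge0.
by rewrite ffunE enorm_le_segnorm.
Qed.

Lemma window_ord0 (R : realType) (n tau : nat) (x : int -> 'cV[R]_n) k :
  window tau x k ord0 = x k%:Z.
Proof. by rewrite ffunE subr0. Qed.

Lemma window_push (R : realType) (n tau : nat) (x : int -> 'cV[R]_n) k :
  window tau x k.+1 = push (window tau x k) (x k.+1%:Z).
Proof.
apply/ffunP => i; rewrite !ffunE; case: unliftP => [j ->|->].
  by rewrite ffunE lift0 /=; congr x; lia.
by rewrite subr0.
Qed.

Lemma segnorm_push_lt (R : realType) (n tau : nat) (phi : seg R n tau.+1)
    (z : 'cV[R]_n) (e : R) :
  segnorm phi < e -> enorm z < e -> segnorm (push phi z) < e.
Proof.
move=> phie ze; apply: segnorm_lt => [|i].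
  exact: le_lt_trans (enorm_ge0 _ _ _) ze.
rewrite ffunE; case: unliftP => [j _|//].
exact: le_lt_trans (enorm_le_segnorm _ _ _ _ _) phie.
Qed.

(** The Lipschitz hypotheses enter stability only through the continuity of
    (phi, z) |-> f(phi, p(z)) at the equilibrium. *)
Lemma rhs_small (R : realType) (n m tau : nat)
    (f : seg R n tau.+1 -> 'cV[R]_m -> 'cV[R]_n) (p : 'cV[R]_n -> 'cV[R]_m)
    (e : R) :
  f 0 0 = 0 -> p 0 = 0 -> locally_lipschitz_vec p -> locally_lipschitz_fun f ->
  0 < e ->
  exists2 d, 0 < d & forall phi z, segnorm phi < d -> enorm z < d ->
    enorm (f phi (p z)) < e.
Proof.
move=> f0 p0 /(_ 0) [lp [rp [lp0 rp0 pP]]].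
move=> /(_ 0 0) [l11 [l12 [l2 [r [l110 l120 l20 r0 fP]]]]] e0.
pose l := l11 + l12 + l2.
have l_gt0 : 0 < l by rewrite /l !addr_gt0.
(* s bounds all three arguments of the Lipschitz estimate, so its right-hand
   side is below l s <= e. *)
have [s [s0 sr sl]] : exists s, [/\ 0 < s, s <= r & s <= e / l].
  exists (Num.min r (e / l)).
  by rewrite lt_min r0 divr_gt0// !ge_min !lexx orbT.
exists (Num.min s (Num.min rp (s / lp))).
  by rewrite !lt_min s0 rp0 divr_gt0.
move=> phi z; rewrite !lt_min => /andP[phis _] /and3P[zs zrp zlp].
have pz : enorm (p z) < s.
  have := pP z; rewrite subr0 p0 subr0 => /(_ zrp) /le_lt_trans; apply.
  by rewrite -ltr_pdivlMl// mulrC.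
have := fP phi (p z); rewrite !subr0 f0 subr0 ffunE subr0.
move=> /(_ (lt_le_trans phis sr) (lt_le_trans pz sr)) /le_lt_trans; apply.
apply: (@lt_le_trans _ _ (l * s)); last first.
  by rewrite -ler_pdivlMl// mulrC.
have h0 := le_lt_trans (enorm_le_segnorm _ _ _ phi ord0) phis.
have h1 := le_lt_trans (segnorm_past_le _ _ _ phi) phis.
rewrite /l !mulrDl; apply: ltrD; last by rewrite ltr_pM2l.
by apply: ltrD; rewrite ltr_pM2l.
Qed.

(** * The closed loop *)

Section ClosedLoop.
Context {R : realType} {n m tau : nat}.
Variables (f : seg R n tau.+1 -> 'cV[R]_m -> 'cV[R]_n)
  (p : 'cV[R]_n -> 'cV[R]_m) (alpha1 chi : R -> R) (sigma a b : R).

(** Every time lies in some interval [k_i, k_{i+1}), because the event times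
    increase strictly. *)
Lemma event_times_cover (x : int -> 'cV[R]_n) (t : nat -> option nat) :
  event_times alpha1 chi sigma a b x t ->
  forall k, exists i ki, [/\ t i = Some ki, (ki <= k)%N & before k (t i.+1)].
Proof.
move=> [t0 tS].
have next i ki : t i = Some ki -> before ki (t i.+1).
  by move=> ti; have := tS i; rewrite ti; case: (t i.+1) => // kj [[]].
elim=> [|k [i [ki [ti kik bk]]]]; first by exists 0%N, 0%N; rewrite t0 next.
case E : (t i.+1) bk => [kj|] /= bk; last first.
  by exists i, ki; rewrite ti E; split=> //; exact: leqW.
move: bk; rewrite leq_eqVlt => /orP[/eqP kj_eq|ltkj]; last first.
  by exists i, ki; rewrite ti E; split=> //; exact: leqW.
by exists i.+1, kj; rewrite E -kj_eq; split=> //; rewrite kj_eq; exact: next.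
Qed.

(** For k > k_i this is the minimality of k_{i+1}; at k = k_i the error is 0. *)
Lemma no_trigger_bound (x : int -> 'cV[R]_n) (t : nat -> option nat) i ki k :
  class_K alpha1 -> class_K chi -> 0 <= sigma -> 0 <= a -> b <= 1 ->
  event_times alpha1 chi sigma a b x t ->
  t i = Some ki -> (ki <= k)%N -> before k (t i.+1) ->
  chi (enorm (x ki%:Z - x k%:Z)) <=
    sigma * alpha1 (enorm (x k%:Z)) + chi (a * (1 - b) ^+ k).
Proof.
move=> K1 Kc s0 a0 b1 [_ tS] ti kik bk; rewrite leNgt; apply/negP => trig.
have [eq_k|ne_k] := eqVneq ki k.
  move: trig; rewrite eq_k subrr enorm0; case: (Kc) => _ _ ->.
  apply/negP; rewrite -leNgt addr_ge0//.
    by rewrite mulr_ge0// class_K_ge0// enorm_ge0.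
  by rewrite class_K_ge0// mulr_ge0// exprn_ge0// subr_ge0.
have kik' : (ki < k)%N by rewrite ltn_neqAle ne_k.
have := tS i; rewrite ti; case: (t i.+1) bk => [kj|] /= bk.
  by move=> [_ /(_ k (conj kik' trig))]; rewrite leqNgt bk.
by move=> /(_ k); apply; split.
Qed.

(** All that the stability argument uses about the input: it is computed from
    some state at a nonnegative time not later than k. *)
Lemma closed_loop_sampled phi x t :
  closed_loop f p alpha1 chi sigma a b phi x t ->
  forall k, exists2 ki, (ki <= k)%N &
    x k.+1%:Z = f (window tau x k) (p (x ki%:Z)).
Proof.
move=> [_ evt step] k.
have [i [ki [ti kik bk]]] := event_times_cover x t evt k.
exists ki => //.
by rewrite (step i ki k ti kik bk) /feedback window_ord0 subrK.
Qed.

(** The radius d depends on K but not on the event times: the sampled state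
    x(k_i) is the value at 0 of the earlier segment x_{k_i}, already known to be
    small. *)
Lemma finite_horizon : f 0 0 = 0 -> p 0 = 0 ->
  locally_lipschitz_vec p -> locally_lipschitz_fun f ->
  forall (K : nat) (e : R), 0 < e -> exists2 d, 0 < d &
    forall phi x t, segnorm phi < d ->
      closed_loop f p alpha1 chi sigma a b phi x t ->
      forall k, (k <= K)%N -> segnorm (window tau x k) < e.
Proof.
move=> f0 p0 lp lf; elim=> [|K IH] e e0.
  exists e => // phi x t phie [w0 _ _] k.
  by rewrite leqn0 => /eqP ->; rewrite w0.
have [d d0 dP] := rhs_small _ _ _ _ f p e f0 p0 lp lf e0.
have [|d' d'0 IHd] := IH (Num.min d e); first by rewrite lt_min d0.
exists d' => // phi x t phid cl.
have small k : (k <= K)%N ->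
    segnorm (window tau x k) < d /\ segnorm (window tau x k) < e.
  by move=> /(IHd _ _ _ phid cl); rewrite lt_min => /andP[].
move=> k; rewrite leq_eqVlt => /orP[/eqP ->|]; last by move=> /small[].
rewrite window_push; apply: segnorm_push_lt; first exact: (small K _).2.
have [ki kiK ->] := closed_loop_sampled _ _ _ cl K.
apply: dP; first exact: (small K _).1.
rewrite -(window_ord0 _ _ tau); apply: le_lt_trans (enorm_le_segnorm _ _ _ _ _) _.
exact: (small ki kiK).1.
Qed.

Lemma threshold_small (e : R) : class_K chi -> 0 <= a -> 0 < b < 1 -> 0 < e ->
  exists K, forall k, (K <= k)%N -> chi (a * (1 - b) ^+ k) <= e.
Proof.
move=> Kc a0 /andP[b0 b1] e0.
have [d d0 de] := class_K_small _ _ _ Kc e0.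
(* a + 1 instead of a, since a may vanish. *)
have a1 : 0 < a + 1 by lra.
have [||K KP] := expr_small _ (1 - b) (d / (a + 1)); first lra.
  exact: divr_gt0.
have q0 : 0 <= 1 - b by lra.
exists K => k /KP /ltW hk; apply: le_trans (ltW de); apply: class_K_le => //.
  by rewrite mulr_ge0// exprn_ge0.
apply: (@le_trans _ _ ((a + 1) * (1 - b) ^+ k)).
  by rewrite ler_wpM2r ?exprn_ge0//; lra.
by rewrite -ler_pdivlMl// mulrC.
Qed.

Variables (V1 : 'cV[R]_n -> R) (V2 : seg R n tau -> R)
  (alpha2 alpha3 : R -> R) (mu : R).
Hypothesis hA : assumptionA f p V1 V2 alpha1 alpha2 alpha3 chi mu.
Hypotheses (hsigma : 0 <= sigma < mu) (ha : 0 <= a) (hb : 0 < b < 1).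

Let V (x : int -> 'cV[R]_n) k := lyapunov V1 V2 (window tau x k).

Lemma alpha1_le_V x k : alpha1 (enorm (x k%:Z)) <= V x k.
Proof.
rewrite /V /lyapunov.
have /andP[h1 _] := A_V1 hA (window tau x k).
have /andP[h2 _] := A_V2 hA (window tau x k).
by move: h1 h2; rewrite window_ord0; lra.
Qed.

Lemma V_le x k : V x k <= alpha2 (enorm (x k%:Z))
                        + alpha3 (segnorm (past (window tau x k))).
Proof.
have /andP[_ h1] := A_V1 hA (window tau x k).
have /andP[_ h2] := A_V2 hA (window tau x k).
by move: h1; rewrite /V /lyapunov window_ord0 => h1; exact: lerD.
Qed.

Lemma V_ge0 x k : 0 <= V x k.
Proof.
apply: le_trans (alpha1_le_V x k).
by rewrite class_K_ge0 ?enorm_ge0//; exact: (A_alpha1 hA).1.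
Qed.

(** The part sigma alpha1(|x(k)|) <= sigma V(x_k) of the triggering threshold
    weakens the rate mu to mu - sigma. *)
Lemma V_decay phi x t : closed_loop f p alpha1 chi sigma a b phi x t ->
  forall k, V x k.+1 <= (1 - (mu - sigma)) * V x k + chi (a * (1 - b) ^+ k).
Proof.
move=> [_ evt step] k; have [s0 _] := andP hsigma.
have [i [ki [ti kik bk]]] := event_times_cover x t evt k.
have b1 : b <= 1 by move: hb; lra.
have K1 := (A_alpha1 hA).1.
have err := no_trigger_bound x t i ki k K1 (A_chi hA) s0 ha b1 evt ti kik bk.
have := A_decay hA (window tau x k) (x ki%:Z - x k%:Z).
rewrite -(step i ki k ti kik bk) -window_push -/(V x k) -/(V x k.+1).
have := ler_wpM2l s0 (alpha1_le_V x k).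
by lra.
Qed.

Lemma V_ultimate phi x t K B : closed_loop f p alpha1 chi sigma a b phi x t ->
  (forall k, (K <= k)%N -> chi (a * (1 - b) ^+ k) <= (mu - sigma) * B) ->
  forall j, V x (K + j)%N <= (1 - (mu - sigma)) ^+ j * V x K
                            + (1 - (1 - (mu - sigma)) ^+ j) * B.
Proof.
move=> cl KP j.
have q0 : 0 <= 1 - (mu - sigma) by have := A_mu hA; move: hsigma; lra.
have := recursion_const _ (fun j => V x (K + j)%N) _ B q0.
rewrite addn0; apply=> i; rewrite addnS.
have := V_decay _ _ _ cl (K + i)%N; have := KP _ (leq_addr i K).
lra.
Qed.

Lemma closed_loop_attractive : globally_attractive f p alpha1 chi sigma a b.
Proof.
move=> phi x t cl; apply/cvgr0Pnorm_lt => e e0.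
have K1 := (A_alpha1 hA).1.
pose B := alpha1 e / 2.
have B0 : 0 < B by apply: divr_gt0 => //; exact: class_K_gt0 K1 e0.
have hmu := A_mu hA.
have c0 : 0 < mu - sigma by move: hsigma; lra.
have [K KP] := threshold_small _ (A_chi hA) ha hb (mulr_gt0 c0 B0).
have VK0 := V_ge0 x K.
have VK1 : 0 < V x K + 1 by lra.
have q01 : 0 <= 1 - (mu - sigma) < 1 by move: hsigma; lra.
have [J JP] := expr_small _ _ _ q01 (divr_gt0 B0 VK1).
exists (K + J)%N => // k /= KJk.
rewrite ger0_norm ?enorm_ge0//.
apply: (class_K_lt_inv _ alpha1) => //; first exact: ltW.
apply: le_lt_trans (alpha1_le_V x k) _.
have Kk : (K <= k)%N := leq_trans (leq_addr _ _) KJk.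
have := V_ultimate _ _ _ _ _ cl KP (k - K)%N.
rewrite subnKC// => /le_lt_trans; apply.
have /JP : (J <= k - K)%N by rewrite leq_subRL.
set z := _ ^+ _.
have z0 : 0 <= z by rewrite exprn_ge0//; case/andP: q01.
rewrite ltr_pdivlMr// mulrDr mulr1.
have zB : 0 <= z * B by rewrite mulr_ge0// ltW.
have -> : alpha1 e = B + B by rewrite /B; lra.
by move=> hz; lra.
Qed.

(** The radius eta at time K is chosen for two purposes: eta <= e settles the
    times k <= K, and alpha2(eta) + alpha3(eta) <= B puts x_K in the
    sublevel set {V <= B}, B = alpha1(e), which is invariant from K on. *)
Lemma closed_loop_stable : f 0 0 = 0 -> p 0 = 0 ->
  locally_lipschitz_vec p -> locally_lipschitz_fun f ->
  stable f p alpha1 chi sigma a b.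
Proof.
move=> f0 p0 lp lf e e0.
have K1 := (A_alpha1 hA).1.
pose B := alpha1 e.
have B0 : 0 < B by exact: class_K_gt0.
have B20 : 0 < B / 2 by rewrite divr_gt0.
have hmu := A_mu hA.
have c0 : 0 < mu - sigma by move: hsigma; lra.
have [K KP] := threshold_small _ (A_chi hA) ha hb (mulr_gt0 c0 B0).
have [d2 d20 d2B] := class_K_small _ _ _ (A_alpha2 hA).1 B20.
have [d3 d30 d3B] := class_K_small _ _ _ (A_alpha3 hA).1 B20.
have eta0 : 0 < Num.min e (Num.min d2 d3) by rewrite !lt_min e0 d20.
have [d d0 dP] := finite_horizon f0 p0 lp lf K _ eta0.
exists d => // phi x t phid cl k.
have small j : (j <= K)%N -> [/\ segnorm (window tau x j) < e,
    segnorm (window tau x j) < d2 & segnorm (window tau x j) < d3].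
  by move=> /(dP _ _ _ phid cl); rewrite !lt_min => /and3P.
have [kK|/ltnW Kk] := leqP k K.
  have [/ltW se _ _] := small k kK.
  rewrite -(window_ord0 _ _ tau); apply: le_trans se.
  exact: enorm_le_segnorm.
apply: (class_K_le_inv _ alpha1) => //; first exact: ltW.
apply: le_trans (alpha1_le_V x k) _.
have VKB : V x K <= B.
  have [_ /ltW s2 /ltW s3] := small K (leqnn K).
  apply: le_trans (V_le x K) _.
  have h2 : alpha2 (enorm (x K%:Z)) <= alpha2 d2.
    apply: class_K_le (A_alpha2 hA).1 (enorm_ge0 _ _ _) _.
    rewrite -(window_ord0 _ _ tau); apply: le_trans s2.
    exact: enorm_le_segnorm.
  have h3 : alpha3 (segnorm (past (window tau x K))) <= alpha3 d3.
    apply: class_K_le (A_alpha3 hA).1 (segnorm_ge0 _ _ _ _) _.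
    exact: le_trans (segnorm_past_le _ _ _ _) s3.
  by lra.
have := V_ultimate _ _ _ _ _ cl KP (k - K)%N.
rewrite subnKC// => /le_trans; apply.
set z := _ ^+ _.
have z0 : 0 <= z by rewrite exprn_ge0//; move: hsigma; lra.
by have := ler_wpM2l z0 VKB; rewrite -/B; lra.
Qed.

(** The strict inequality, which is what puts the states in the open ball of
    radius alpha1^{-1}(M), comes from the term -(1-c)^k a L / (c - b) of the
    solution of the recursion; L > 0 since chi is strictly increasing. *)
Lemma V_exponential phi x t L : closed_loop f p alpha1 chi sigma a b phi x t ->
  0 < a -> b < mu - sigma -> L.-lipschitz_(`[0, a]%classic) chi ->
  forall k, V x k < (a * L / (mu - sigma - b) + Mtilde alpha2 alpha3 phi)
                    * (1 - b) ^+ k.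
Proof.
move=> cl a0 bc lip k; have hmu := A_mu hA.
have hchi y : 0 <= y <= a -> chi y <= L * y.
  exact: class_K_lipschitz_bound (A_chi hA) lip.
have L0 : 0 < L.
  have := class_K_gt0 _ _ _ (A_chi hA) a0.
  move=> /lt_le_trans /(_ (hchi a _)); rewrite lexx ltW// => /(_ isT).
  by rewrite pmulr_lgt0.
have V0 : V x 0 <= Mtilde alpha2 alpha3 phi.
  by have := V_le x 0; case: cl => <- _ _; rewrite /Mtilde window_ord0.
have q0 : 0 < 1 - (mu - sigma) by move: hsigma; lra.
have qs : 1 - (mu - sigma) < 1 - b by lra.
have s1 : 0 <= 1 - b <= 1 by move: hb; lra.
have := recursion_geometric _ (V x) _ _ (L * a) (ltW q0) qs.
have step j : V x j.+1 <= (1 - (mu - sigma)) * V x j + L * a * (1 - b) ^+ j.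
  apply: le_trans (V_decay _ _ _ cl j) _; rewrite lerD2l -mulrA hchi//.
  case/andP: s1 => s0 s1.
  by rewrite mulr_ge0 ?exprn_ge0// ger_pMr// exprn_ile1.
move=> /(_ step k) /le_lt_trans; apply.
have -> : L * a / (1 - b - (1 - (mu - sigma))) = a * L / (mu - sigma - b).
  by rewrite (mulrC L); congr (_ / _); ring.
set Mb := a * L / _.
have Mb0 : 0 < Mb by rewrite !(mulr_gt0, invr_gt0)//; lra.
have qk0 : 0 < (1 - (mu - sigma)) ^+ k by exact: exprn_gt0.
have qk : (1 - (mu - sigma)) ^+ k <= (1 - b) ^+ k.
  by rewrite lerXn2r ?nnegrE//; lra.
move: qk0 qk; set z := _ ^+ k; set w := _ ^+ k => z0 zw.
have h1 : z * V x 0 <= w * Mtilde alpha2 alpha3 phi.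
  by apply: ler_pM => //; [exact: ltW|exact: V_ge0].
have := mulr_gt0 Mb0 z0.
lra.
Qed.

(** The two conclusions serve different ends: the first places the state in the
    ball where the Lipschitz constants of f are valid, the second gives the
    rate. *)
Lemma state_decay x M L1 : (forall k, V x k < M * (1 - b) ^+ k) ->
  L1.-lipschitz_(`[0, M]%classic) (Kinv alpha1) ->
  forall k : nat, enorm (x k%:Z) < Kinv alpha1 M /\
    enorm (x k%:Z) <= M * L1 * (1 - b) ^+ k.
Proof.
move=> VM lip k; have K1 := (A_alpha1 hA).1.
have M0 : 0 < M.
  by have := VM 0%N; rewrite expr0 mulr1; exact: le_lt_trans (V_ge0 x 0).
have s01 : 0 <= 1 - b <= 1 by move: hb; lra.
have sk1 : (1 - b) ^+ k <= 1 by case/andP: s01 => *; exact: exprn_ile1.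
have sk0 : 0 <= (1 - b) ^+ k by case/andP: s01 => *; exact: exprn_ge0.
have aM := le_lt_trans (alpha1_le_V x k) (VM k).
have MkM : M * (1 - b) ^+ k <= M by rewrite ger_pMr.
split.
  apply: lt_Kinv (A_alpha1 hA) (enorm_ge0 _ _ _) _.
  exact: lt_le_trans aM MkM.
apply: le_trans (ltW (lt_Kinv _ _ _ _ (A_alpha1 hA) (enorm_ge0 _ _ _) aM)) _.
rewrite (mulrC M L1) -mulrA.
by apply: Kinv_lipschitz_bound (A_alpha1 hA) lip _; rewrite MkM mulr_ge0// ltW.
Qed.

(** The oldest entry of x_k is the state at time k - tau, whence the factor
    (1-b)^{-tau}. A state at a negative time is bounded by alpha1^{-1}(M) <= M L1,
    which is enough: it occurs only if k < tau, and then the factor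
    (1-b)^{k-tau} is at least 1. *)
Lemma window_decay phi x t M L1 k : closed_loop f p alpha1 chi sigma a b phi x t ->
  (forall k, V x k < M * (1 - b) ^+ k) ->
  L1.-lipschitz_(`[0, M]%classic) (Kinv alpha1) ->
  (tau <= k)%N \/ segnorm phi < Kinv alpha1 M ->
  forall i, enorm (window tau x k i) < Kinv alpha1 M /\
    enorm (window tau x k i) <= M * L1 * ((1 - b) ^+ k / (1 - b) ^+ tau).
Proof.
move=> [w0 _ _] VM lip hk i.
have st := state_decay x M L1 VM lip.
have s0 : 0 < 1 - b by move: hb; lra.
have s1 : 1 - b <= 1 by move: hb; lra.
have M0 : 0 < M.
  by have := VM 0%N; rewrite expr0 mulr1; exact: le_lt_trans (V_ge0 x 0).
have rD : Kinv alpha1 M <= M * L1.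
  rewrite mulrC; apply: Kinv_lipschitz_bound (A_alpha1 hA) lip _.
  by rewrite lexx ltW.
have D0 : 0 <= M * L1.
  exact: le_trans (enorm_ge0 _ _ (x 0)) (le_trans (ltW (st 0%N).1) rD).
have itau : (i <= tau)%N by rewrite -ltnS.
(* Entry i is the state at time k - i, which may be negative. *)
rewrite ffunE; have [ik|ki] := leqP i k.
  rewrite subzn//.
  have [xr xD] := st (k - i)%N; split=> //; apply: le_trans xD _.
  rewrite ler_wpM2l// ler_pdivlMr ?exprn_gt0// -exprD.
  by rewrite ler_wiXn2l ?(ltW s0)// -{1}(subnK ik) leq_add2l.
have ktau : (k < tau)%N := leq_trans ki itau.
have phir : segnorm phi < Kinv alpha1 M.
  by case: hk => //; rewrite leqNgt ktau.
have jlt : (i - k < tau.+1)%N := leq_ltn_trans (leq_subr k i) (ltn_ord i).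
have -> : x (k%:Z - i%:Z) = phi (Ordinal jlt).
  by rewrite -w0 ffunE /= -(subzn (ltnW ki)) sub0r opprB.
have xr := le_lt_trans (enorm_le_segnorm _ _ _ phi (Ordinal jlt)) phir.
split=> //; apply: le_trans (ltW xr) (le_trans rD _).
rewrite ler_peMr// ler_pdivlMr ?exprn_gt0// mul1r.
by rewrite ler_wiXn2l//; [exact: ltW|exact: ltnW].
Qed.

(** If the error after one step is at most a(1-b)^{k_i+1}, monotonicity of chi
    excludes an event at k_i + 1. *)
Lemma no_immediate_event phi x t i ki kj :
  closed_loop f p alpha1 chi sigma a b phi x t ->
  t i = Some ki -> t i.+1 = Some kj ->
  enorm (x ki%:Z - x ki.+1%:Z) <= a * (1 - b) ^+ ki.+1 -> (ki + 2 <= kj)%N.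
Proof.
move=> [_ [_ tS] _] ti tj small.
have := tS i; rewrite ti tj => -[[kij trig] _].
rewrite addn2 ltn_neqAle kij andbT; apply/eqP => kj_eq.
move: trig; rewrite -kj_eq; apply/negP; rewrite -leNgt.
apply: (le_trans (class_K_le _ _ _ _ (A_chi hA) (enorm_ge0 _ _ _) small)).
rewrite lerDr mulr_ge0//; first by case/andP: hsigma.
exact: class_K_ge0 (A_alpha1 hA).1 (enorm_ge0 _ _ _).
Qed.

Lemma inter_event_gap phi x t M L1 L11 L12 L2 i ki kj :
  closed_loop f p alpha1 chi sigma a b phi x t ->
  (forall k, V x k < M * (1 - b) ^+ k) ->
  L1.-lipschitz_(`[0, M]%classic) (Kinv alpha1) ->
  fbar_lipschitz f p (Kinv alpha1 M) L11 L12 L2 ->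
  a >= M * L1 / (1 - b) * (L11 + L12 / (1 - b) ^+ tau + L2) ->
  t i = Some ki -> t i.+1 = Some kj ->
  (tau <= ki)%N \/ segnorm phi < Kinv alpha1 M -> (ki + 2 <= kj)%N.
Proof.
move=> cl VM lip [L110 L120 L20 fbar] hbig ti tj hk.
apply: (no_immediate_event _ _ _ _ _ _ cl ti tj).
have st := state_decay x M L1 VM lip.
have win := window_decay _ _ _ _ _ ki cl VM lip hk.
have [xr xD] := st ki.
have gap : (ki < kj)%N.
  by case: (cl) => _ [_ /(_ i)] + _; rewrite ti tj => -[[]].
have -> : x ki.+1%:Z = f (window tau x ki) (p (x ki%:Z)).
  case: (cl) => _ _ /(_ i ki ki ti (leqnn ki)); rewrite tj => /(_ gap) ->.
  by rewrite /feedback subrr add0r window_ord0.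
have r0 : 0 < Kinv alpha1 M by exact: le_lt_trans (enorm_ge0 _ _ _) xr.
have wr : segnorm (window tau x ki) < Kinv alpha1 M.
  by apply: segnorm_lt => // j; case: (win j).
have s0 : 0 < 1 - b by move: hb; lra.
have D0 : 0 <= M * L1 * ((1 - b) ^+ ki / (1 - b) ^+ tau).
  exact: le_trans (enorm_ge0 _ _ _) (win ord0).2.
have wD : segnorm (past (window tau x ki)) <=
    M * L1 * ((1 - b) ^+ ki / (1 - b) ^+ tau).
  by apply: segnorm_le => // j; rewrite ffunE; case: (win (lift ord0 j)).
have := fbar (window tau x ki) (x ki%:Z) wr xr; rewrite window_ord0.
move=> /le_trans; apply.
apply: (@le_trans _ _ (L11 * (M * L1 * (1 - b) ^+ ki) +
  L12 * (M * L1 * ((1 - b) ^+ ki / (1 - b) ^+ tau)) +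
  L2 * (M * L1 * (1 - b) ^+ ki))).
  by apply: lerD; [apply: lerD|]; exact: ler_wpM2l.
rewrite exprS.
have := ler_wpM2r (exprn_ge0 ki.+1 (ltW s0)) hbig; rewrite exprS.
apply: le_trans; rewrite le_eqVlt; apply/orP; left; apply/eqP.
field; by rewrite expf_neq0 lt0r_neq0.
Qed.

End ClosedLoop.

Theorem theorem2 (R : realType) (n m tau : nat)
    (f : seg R n tau.+1 -> 'cV[R]_m -> 'cV[R]_n) (p : 'cV[R]_n -> 'cV[R]_m)
    (V1 : 'cV[R]_n -> R) (V2 : seg R n tau -> R)
    (alpha1 alpha2 alpha3 chi : R -> R) (mu sigma a b : R)
    (f0 : f 0 0 = 0) (p0 : p 0 = 0)
    (hA : assumptionA f p V1 V2 alpha1 alpha2 alpha3 chi mu)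
    (hB : assumptionB f p alpha1 chi)
    (hsigma : 0 <= sigma < mu) (ha : 0 <= a) (hb : 0 < b < 1) :
  let c := mu - sigma in
  (a = 0 -> 0 < sigma -> GAS f p alpha1 chi sigma a b) /\
  (0 < a ->
     GAS f p alpha1 chi sigma a b /\
     (b < c ->
      forall (phi : seg R n tau.+1) (x : int -> 'cV[R]_n)
             (t : nat -> option nat) (xi L L1 L11 L12 L2 : R),
        closed_loop f p alpha1 chi sigma a b phi x t ->
        0 < xi < b ->
        L.-lipschitz_(`[0, a]%classic) chi ->
        let M := Mbar a b c L xi + Mtilde alpha2 alpha3 phi in
        let r := Kinv alpha1 M in
        L1.-lipschitz_(`[0, M]%classic) (Kinv alpha1) ->
        fbar_lipschitz f p r L11 L12 L2 ->
        a >= M * L1 / (1 - b) * (L11 + L12 / (1 - b) ^+ tau + L2) ->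
        strongly_nontrivial_from tau t /\
        (segnorm phi < r -> strongly_nontrivial t))).
Proof.
have [_ _ lp lf] := hB.
have gas : GAS f p alpha1 chi sigma a b.
  split.
    exact: (closed_loop_stable _ _ _ _ _ _ _ _ _ _ _ _ hA hsigma ha hb).
  exact: (closed_loop_attractive _ _ _ _ _ _ _ _ _ _ _ _ hA hsigma ha hb).
move=> c; split=> // a0; split=> // bc phi x t xi L L1 L11 L12 L2 cl _ lipL.
move=> M r lip1 fbar hbig.
have VM k : lyapunov V1 V2 (window tau x k) < M * (1 - b) ^+ k.
  rewrite /M /Mbar lt_eqF// gtr0_norm ?subr_gt0//.
  exact: (V_exponential _ _ _ _ _ _ _ _ _ _ _ _ hA hsigma ha hb phi x t).
have gap i ki kj := inter_event_gap _ _ _ _ _ _ _ _ _ _ _ _ hA hsigma hb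
  phi x t M L1 L11 L12 L2 i ki kj cl VM lip1 fbar hbig.
split=> [|phir] i ki kj ti tj k0; apply: gap ti tj _; first by left.
by right.
Qed.
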